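(* Let $T>0$ and $\Omega=(0,T)\times(0,1)$. Let $H:[0,1]\times\mathbb{R}\to\mathbb{R}$ satisfy $H\in C^1([0,1]\times\mathbb{R})$, $D_pH\in C^1([0,1]\times\mathbb{R})$, and, for every $x\in[0,1]$, $\lim_{|p|\to\infty}H(x,p)/|p|=+\infty$ and $D_{pp}H(x,p)>0$ for all $p\in\mathbb{R}$. Let $m_0,m_T\in C^1([0,1])$ be strictly positive on $[0,1]$ with $\int_0^1 m_0\,dx=\int_0^1 m_T\,dx=1$. Then there is at most one classical solution $\varphi\in C^2(\overline{\Omega})$ with $\varphi_x>0$ on $\overline{\Omega}$ of the problem $$\big(F_j(x,-\varphi_t,\varphi_x)\big)_t+\big(-F_m(x,-\varphi_t,\varphi_x)\big)_x-\varphi_x=0\quad\text{in }\Omega,\qquad \varphi=\varphi^0\quad\text{on }\partial\Omega .$$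
   Context: Points of $\Omega$ are written $(t,x)$. The Lagrangian is $L(x,v)=\sup_{p\in\mathbb{R}}(-vp-H(x,p))$. The perspective function is $F(x,j,m)=\sup_{p\in\mathbb{R}}(-jp-mH(x,p))$; for $m>0$ it equals $F(x,j,m)=m\,L(x,j/m)$. $F_j,F_m$ denote its partial derivatives in $j$ and $m$ (at $m>0$). The reference potential is $$\varphi^0(t,x)=\frac{T-t}{T}\int_0^x m_0(y)\,dy+\frac{t}{T}\int_0^x m_T(y)\,dy .$$ *)

(* Defs.v *)
From Stdlib Require Import Reals.
From Coquelicot Require Import Coquelicot.
Open Scope R_scope.

(** * Derivatives relative to a set

    [is_derive_on D] is [is_derive] with the filter [locally x] restricted to
    [D]: the usual derivative at interior points of an interval [D], the
    one-sided derivative at an endpoint belonging to [D]. *)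

Definition is_derive_on (D : R -> Prop) (f : R -> R) (x l : R) : Prop :=
  filterdiff f (within D (locally x)) (fun y : R => scal y l).

Definition ex_derive_on (D : R -> Prop) (f : R -> R) (x : R) : Prop :=
  exists l : R, is_derive_on D f x l.

Definition Derive_on (D : R -> Prop) (f : R -> R) (x : R) : R :=
  iota (is_derive_on D f x).

Definition pderiv1 (D : R * R -> Prop) (f : R -> R -> R) (a b : R) : R :=
  Derive_on (fun s => D (s, b)) (fun s => f s b) a.

Definition pderiv2 (D : R * R -> Prop) (f : R -> R -> R) (a b : R) : R :=
  Derive_on (fun s => D (a, s)) (fun s => f a s) b.

(** The sets to which these classes are applied are intervals and products of
    intervals, where relative differentiability is equivalent to requiring that
    the derivatives on the interior extend continuously to the whole set. *)

Definition C1_on_R (D : R -> Prop) (f : R -> R) : Prop :=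
  continuous_on D f /\
  (forall x, D x -> ex_derive_on D f x) /\
  continuous_on D (Derive_on D f).

Definition C0_on (D : R * R -> Prop) (f : R -> R -> R) : Prop :=
  continuous_on D (fun z : R * R => f (fst z) (snd z)).

Definition C1_on (D : R * R -> Prop) (f : R -> R -> R) : Prop :=
  C0_on D f /\
  (forall a b, D (a, b) ->
     ex_derive_on (fun s => D (s, b)) (fun s => f s b) a /\
     ex_derive_on (fun s => D (a, s)) (fun s => f a s) b) /\
  C0_on D (pderiv1 D f) /\
  C0_on D (pderiv2 D f).

Definition C2_on (D : R * R -> Prop) (f : R -> R -> R) : Prop :=
  C1_on D f /\ C1_on D (pderiv1 D f) /\ C1_on D (pderiv2 D f).

(** * Domains *)

Definition I01 (x : R) : Prop := 0 <= x <= 1.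

(** [[0,1] x R], with points written [(x, p)]. *)
Definition strip (z : R * R) : Prop := I01 (fst z).

(** Points of the space-time domain are written [(t, x)]. *)
Definition Omega (T : R) (z : R * R) : Prop :=
  0 < fst z < T /\ 0 < snd z < 1.

Definition Omega_bar (T : R) (z : R * R) : Prop :=
  0 <= fst z <= T /\ 0 <= snd z <= 1.

Definition bd_Omega (T : R) (z : R * R) : Prop :=
  Omega_bar T z /\ ~ Omega T z.

(** * Hamiltonian and perspective function *)

Definition DpH (H : R -> R -> R) (x p : R) : R := Derive (fun q => H x q) p.

Definition DppH (H : R -> R -> R) (x p : R) : R := Derive (fun q => DpH H x q) p.

Definition F (H : R -> R -> R) (x j m : R) : Rbar :=
  Lub_Rbar (fun y => exists p : R, y = - j * p - m * H x p).

(** Only used at [m > 0], where [F] is finite for superlinear [H]. *)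

Definition F_j (H : R -> R -> R) (x j m : R) : R :=
  Derive (fun j' => real (F H x j' m)) j.

Definition F_m (H : R -> R -> R) (x j m : R) : R :=
  Derive (fun m' => real (F H x j m')) m.

(** * The boundary value problem *)

Definition phi0 (T : R) (m0 mT : R -> R) (t x : R) : R :=
  (T - t) / T * RInt m0 0 x + t / T * RInt mT 0 x.

(** For [H] satisfying the assumptions of the theorem, [F_j] and [F_m] are [C^1]
    where [m > 0], so the derivatives in the equation exist for every [phi] of
    class [C^2] with [phi_x > 0]; no separate existence clause is needed. *)
Definition classical_solution (T : R) (H : R -> R -> R) (m0 mT : R -> R)
    (phi : R -> R -> R) : Prop :=
  let phi_t := pderiv1 (Omega_bar T) phi in
  let phi_x := pderiv2 (Omega_bar T) phi in
  C2_on (Omega_bar T) phi /\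
  (forall t x, Omega_bar T (t, x) -> 0 < phi_x t x) /\
  (forall t x, Omega T (t, x) ->
     Derive (fun s => F_j H x (- phi_t s x) (phi_x s x)) t
     + Derive (fun y => - F_m H y (- phi_t t y) (phi_x t y)) x
     - phi_x t x = 0) /\
  (forall t x, bd_Omega T (t, x) -> phi t x = phi0 T m0 mT t x).

(* Main.v *)
(* Write phi_t = phi_x D_pH(x,P): the equation becomes -P_t + (H(x,P))_x = phi_x,
   because F_j = -P and F_m = -H(x,P) by the envelope theorem. For two solutions
   phi, psi with costates P, Q, put w = phi - psi, which vanishes on the boundary.
   Multiplying the difference of the equations by w, the right-hand side
   w w_x = (w^2/2)_x is a pure divergence, and what remains is

     div ((Q - P) w, (H(x,P) - H(x,Q) - w/2) w) = - G,

   where G is the Bregman sum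
     phi_x (H(x,Q) - H(x,P) - D_pH(x,P)(Q-P)) + psi_x (H(x,P) - H(x,Q) - D_pH(x,Q)(P-Q)),
   nonnegative and zero only where P = Q. Hence G = 0 and P = Q, and then the
   equations themselves give phi_x = psi_x, so w = 0. *)

Require Import Defs.
From Stdlib Require Import Reals Lra.
From Coquelicot Require Import Coquelicot.
Open Scope R_scope.

(** * The divergence argument *)

(** Nonnegativity lets the two outer pieces be dropped. A positive [c] measures the mass of [G] near
    a point where it is positive; [c = 0] gives a nonnegative integral. *)
Lemma RInt_ge_subinterval (f : R -> R) (a b a' b' c : R) :
  a <= a' -> a' <= b' -> b' <= b ->
  (forall x, a <= x <= b -> continuous f x) ->
  (forall x, a <= x <= b -> 0 <= f x) ->
  (forall x, a' <= x <= b' -> c <= f x) ->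
  c * (b' - a') <= RInt f a b.
Proof.
  intros Ha Hab Hb Hc H0 Hlow.
  assert (ex : forall u v, a <= u -> u <= v -> v <= b -> ex_RInt f u v).
  { intros u v Hu Huv Hv.
    apply (ex_RInt_continuous (V := R_CompleteNormedModule)). intros z Hz. apply Hc.
    rewrite Rmin_left in Hz by lra. rewrite Rmax_right in Hz by lra. lra. }
  assert (pos : forall u v, a <= u -> u <= v -> v <= b -> 0 <= RInt f u v).
  { intros u v Hu Huv Hv. apply RInt_ge_0; auto. intros; apply H0; lra. }
  assert (E1 : RInt f a b = RInt f a a' + RInt f a' b).
  { symmetry. apply (RInt_Chasles f); apply ex; lra. }
  assert (E2 : RInt f a' b = RInt f a' b' + RInt f b' b).
  { symmetry. apply (RInt_Chasles f); apply ex; lra. }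
  assert (E3 : RInt (fun _ => c) a' b' <= RInt f a' b').
  { apply RInt_le; auto using ex_RInt_const. intros; apply Hlow; lra. }
  rewrite RInt_const in E3. change (scal (b' - a') c) with ((b' - a') * c) in E3.
  pose proof (pos a a'). pose proof (pos b' b). lra.
Qed.

Lemma MVT_le (f df : R -> R) (a b k : R) :
  a <= b ->
  (forall x, a <= x <= b -> is_derive f x (df x)) ->
  (forall x, a <= x <= b -> df x <= k) ->
  f b - f a <= k * (b - a).
Proof.
  intros Hab Hd Hk.
  destruct (MVT_gen f a b df) as [c [Hc E]].
  - rewrite Rmin_left, Rmax_right by lra. intros; apply Hd; lra.
  - rewrite Rmin_left, Rmax_right by lra. intros x Hx. apply continuity_pt_filterlim.
    apply (ex_derive_continuous f). exists (df x). now apply Hd.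
  - rewrite Rmin_left, Rmax_right in Hc by lra. rewrite E.
    apply Rmult_le_compat_r; [lra | now apply Hk].
Qed.

Lemma Omega_open (T t x : R) : Omega T (t, x) -> locally (t, x) (Omega T).
Proof.
  intros [[H1 H2] [H3 H4]]. simpl in *.
  assert (He : 0 < Rmin (Rmin t (T - t)) (Rmin x (1 - x))).
  { repeat apply Rmin_case; lra. }
  exists (mkposreal _ He). intros [u v] [Hu Hv]. simpl in Hu, Hv.
  change (Rabs (u - t) < Rmin (Rmin t (T - t)) (Rmin x (1 - x))) in Hu.
  change (Rabs (v - x) < Rmin (Rmin t (T - t)) (Rmin x (1 - x))) in Hv.
  pose proof (Rmin_l (Rmin t (T - t)) (Rmin x (1 - x))).
  pose proof (Rmin_r (Rmin t (T - t)) (Rmin x (1 - x))).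
  pose proof (Rmin_l t (T - t)). pose proof (Rmin_r t (T - t)).
  pose proof (Rmin_l x (1 - x)). pose proof (Rmin_r x (1 - x)).
  apply Rabs_def2 in Hu, Hv. unfold Omega; simpl. lra.
Qed.

Lemma locally_section1 (D : R * R -> Prop) (a b : R) :
  locally (a, b) D -> locally a (fun s => D (s, b)).
Proof.
  intros [e He]. exists e. intros s Hs. apply He. split; [exact Hs | apply ball_center].
Qed.

Lemma locally_section2 (D : R * R -> Prop) (a b : R) :
  locally (a, b) D -> locally b (fun s => D (a, s)).
Proof.
  intros [e He]. exists e. intros s Hs. apply He. split; [apply ball_center | exact Hs].
Qed.

Lemma continuity_2d_pt_section1 (f : R -> R -> R) (a b : R) :
  continuity_2d_pt f a b -> continuous (fun s => f s b) a.
Proof.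
  intros H. apply continuity_2d_pt_filterlim in H. intros P HP.
  apply (locally_section1 (fun z => P (f (fst z) (snd z)))). exact (H P HP).
Qed.

Lemma continuity_2d_pt_section2 (f : R -> R -> R) (a b : R) :
  continuity_2d_pt f a b -> continuous (fun s => f a s) b.
Proof.
  intros H. apply continuity_2d_pt_filterlim in H. intros P HP.
  apply (locally_section2 (fun z => P (f (fst z) (snd z)))). exact (H P HP).
Qed.

(** Only points of the open domain enter, with one [r] for all of them. The divergence argument can
    thus stay inside [Omega], where derivatives are two-sided. *)
Definition vanishes_at_boundary (T : R) (f : R -> R -> R) : Prop :=
  forall eps : R, 0 < eps -> exists r : R, 0 < r /\ forall t x,
    Omega T (t, x) -> t <= r \/ T - r <= t \/ x <= r \/ 1 - r <= x ->
    Rabs (f t x) <= eps.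

(* The divergence theorem on subrectangles approaching [Omega]; the double
   integral is never formed: [t => RInt (A t) a b] is differentiated instead. *)
Lemma divergence_nonpos_eq_0 (T : R) (A At B G : R -> R -> R) :
  0 < T ->
  vanishes_at_boundary T A -> vanishes_at_boundary T B ->
  (forall t x, Omega T (t, x) -> is_derive (fun s => A s x) t (At t x)) ->
  (forall t x, Omega T (t, x) -> continuous (A t) x) ->
  (forall t x, Omega T (t, x) -> continuity_2d_pt At t x) ->
  (forall t x, Omega T (t, x) -> is_derive (B t) x (- G t x - At t x)) ->
  (forall t x, Omega T (t, x) -> continuity_2d_pt G t x) ->
  (forall t x, Omega T (t, x) -> 0 <= G t x) ->
  forall t x, Omega T (t, x) -> G t x = 0.
Proof.
  intros HT A0 B0 dA cA cAt dB cG G0 t0 x0 Hz.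
  destruct (Req_dec (G t0 x0) 0) as [E | NE]; [exact E | exfalso].
  assert (Gpos : 0 < G t0 x0) by (pose proof (G0 _ _ Hz); lra).
  (* By continuity [G] stays above half its value at the point on a square of half-width [d]. The
     mass of that square, at least [4 * d * d * c], will be too large for the boundary terms to
     balance. *)
  pose (c := G t0 x0 / 2). assert (c_pos : 0 < c) by (unfold c; lra).
  destruct (cG _ _ Hz (mkposreal _ c_pos)) as [del Hdel]. simpl in Hdel.
  destruct Hz as [[Ht1 Ht2] [Hx1 Hx2]]; simpl in *.
  (* With [d] at most half of each distance to the boundary, the square fits between [r] and [T - r]
     in time and between [r] and [1 - r] in space as soon as [r <= d]. *)
  assert (exists d, 0 < d /\ d < del /\ d <= t0 / 2 /\ d <= (T - t0) / 2
                    /\ d <= x0 / 2 /\ d <= (1 - x0) / 2) as (d & d1 & d2 & d3 & d4 & d5 & d6).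
  { exists (Rmin (del / 2) (Rmin (Rmin (t0 / 2) ((T - t0) / 2)) (Rmin (x0 / 2) ((1 - x0) / 2)))).
    pose proof (cond_pos del).
    split; [repeat apply Rmin_case; lra |].
    pose proof (Rmin_l (del / 2) (Rmin (Rmin (t0 / 2) ((T - t0) / 2)) (Rmin (x0 / 2) ((1 - x0) / 2)))).
    pose proof (Rmin_r (del / 2) (Rmin (Rmin (t0 / 2) ((T - t0) / 2)) (Rmin (x0 / 2) ((1 - x0) / 2)))).
    pose proof (Rmin_l (Rmin (t0 / 2) ((T - t0) / 2)) (Rmin (x0 / 2) ((1 - x0) / 2))).
    pose proof (Rmin_r (Rmin (t0 / 2) ((T - t0) / 2)) (Rmin (x0 / 2) ((1 - x0) / 2))).
    pose proof (Rmin_l (t0 / 2) ((T - t0) / 2)). pose proof (Rmin_r (t0 / 2) ((T - t0) / 2)).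
    pose proof (Rmin_l (x0 / 2) ((1 - x0) / 2)). pose proof (Rmin_r (x0 / 2) ((1 - x0) / 2)).
    lra. }
  assert (Glow : forall t x, t0 - d <= t <= t0 + d -> x0 - d <= x <= x0 + d -> c <= G t x).
  { intros t x Ht Hx. assert (Hb : Rabs (G t x - G t0 x0) < c).
    { apply Hdel; apply Rabs_def1; lra. }
    apply Rabs_def2 in Hb. unfold c in *. lra. }
  (* The flux through the four sides of the rectangle is at most [2 * eps + 2 * eps * (T - 2 * r)],
     hence below [2 * eps * (T + 1)]. This [eps] makes that [2 * d * d * c], half the lower bound
     for the mass of the square. *)
  pose (eps := d * d * c / (T + 1)).
  assert (eps_pos : 0 < eps).
  { unfold eps. apply Rdiv_lt_0_compat; [repeat apply Rmult_lt_0_compat; lra | lra]. }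
  assert (Eeps : eps * (T + 1) = d * d * c) by (unfold eps; field; lra).
  destruct (A0 eps eps_pos) as (rA & rA0 & HrA).
  destruct (B0 eps eps_pos) as (rB & rB0 & HrB).
  assert (exists r, 0 < r /\ r <= rA /\ r <= rB /\ r <= d) as (r & r0 & r1 & r2 & r3).
  { exists (Rmin (Rmin rA rB) d). pose proof (Rmin_l (Rmin rA rB) d).
    pose proof (Rmin_r (Rmin rA rB) d). pose proof (Rmin_l rA rB). pose proof (Rmin_r rA rB).
    repeat split; try lra. repeat apply Rmin_case; lra. }
  pose (J := fun t => RInt (fun x => A t x) r (1 - r)).
  assert (inO : forall t x, 0 < t < T -> r <= x <= 1 - r -> Omega T (t, x)).
  { intros t x Ht Hx. unfold Omega; simpl; lra. }
  assert (dJ : forall t, 0 < t < T ->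
    is_derive J t (- RInt (fun x => G t x) r (1 - r) - (B t (1 - r) - B t r))).
  { intros t Ht.
    assert (Hloc : locally t (fun s => 0 < s < T)).
    { apply (locally_section1 (fun z => 0 < fst z < T) t x0).
      eapply filter_imp; [| apply Omega_open; apply (inO t x0); lra].
      intros z [Hz _]; exact Hz. }
    (* [At] is split as [- G] minus the [x]-derivative of [B], and the second term integrates to the
       increment of [B]. *)
    assert (E : RInt (fun x => Derive (fun u => A u x) t) r (1 - r)
                = - RInt (fun x => G t x) r (1 - r) - (B t (1 - r) - B t r)).
    { apply is_RInt_unique.
      apply is_RInt_ext with (f := fun x => minus (opp (G t x)) (- G t x - At t x)).
      { intros x Hx. rewrite Rmin_left, Rmax_right in Hx by lra.
        rewrite (is_derive_unique _ _ _ (dA t x (inO t x Ht ltac:(lra)))).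
        unfold minus, plus, opp; simpl. ring. }
      apply (is_RInt_minus (V := R_NormedModule)).
      - apply (is_RInt_opp (V := R_NormedModule)). apply (RInt_correct (V := R_CompleteNormedModule)).
        apply (ex_RInt_continuous (V := R_CompleteNormedModule)). intros x Hx.
        rewrite Rmin_left, Rmax_right in Hx by lra.
        apply continuity_2d_pt_section2. apply cG. apply inO; lra.
      - apply (is_RInt_derive (V := R_CompleteNormedModule) (B t)); intros x Hx;
          rewrite Rmin_left, Rmax_right in Hx by lra.
        + apply dB. apply inO; lra.
        + apply (continuity_2d_pt_section2 (fun t x => - G t x - At t x)).
          apply continuity_2d_pt_minus; [apply continuity_2d_pt_opp |];
            [apply cG | apply cAt]; apply inO; lra. }
    rewrite <- E. unfold J.
    apply (is_derive_RInt_param A r (1 - r) t).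
    - eapply filter_imp; [| exact Hloc]. intros s Hs x Hx.
      rewrite Rmin_left, Rmax_right in Hx by lra. exists (At s x). apply dA. apply inO; lra.
    - intros x Hx. rewrite Rmin_left, Rmax_right in Hx by lra.
      apply continuity_2d_pt_ext_loc with (f := At); [| apply cAt; apply inO; lra].
      apply locally_2d_locally.
      eapply filter_imp; [| apply Omega_open; apply (inO t x); lra].
      intros [u v] Huv. simpl. symmetry. apply is_derive_unique. now apply dA.
    - eapply filter_imp; [| exact Hloc]. intros s Hs.
      apply (ex_RInt_continuous (V := R_CompleteNormedModule)). intros x Hx.
      rewrite Rmin_left, Rmax_right in Hx by lra. apply cA. apply inO; lra. }
  assert (HB : forall t, 0 < t < T -> - (B t (1 - r) - B t r) <= 2 * eps).
  { intros t Ht.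
    assert (Rabs (B t (1 - r)) <= eps) by (apply HrB; [apply inO; lra | lra]).
    assert (Rabs (B t r) <= eps) by (apply HrB; [apply inO; lra | lra]).
    pose proof (Rabs_maj2 (B t (1 - r))). pose proof (Rle_abs (B t r)). lra. }
  assert (cGx : forall t x, 0 < t < T -> r <= x <= 1 - r -> continuous (fun y => G t y) x).
  { intros t x Ht Hx. apply continuity_2d_pt_section2. apply cG. now apply inO. }
  assert (HJ : forall t, 0 < t < T -> t <= r \/ T - r <= t -> Rabs (J t) <= eps).
  { intros t Ht Hr.
    assert (Hb : Rabs (J t) <= (1 - r - r) * eps).
    { apply abs_RInt_le_const; [lra | |].
      - apply (ex_RInt_continuous (V := R_CompleteNormedModule)). intros x Hx.
        rewrite Rmin_left, Rmax_right in Hx by lra. apply cA. apply inO; lra.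
      - intros x Hx. apply HrA; [apply inO; lra | lra]. }
    assert ((1 - r - r) * eps <= 1 * eps) by (apply Rmult_le_compat_r; lra). lra. }
  (* Time is cut at [t0 - d] and [t0 + d]. The outer intervals use only [G >= 0]; the middle one
     gains [2 * d * c] per unit time from the square. The sum contradicts the bound [eps] on [J] at
     [r] and [T - r]. *)
  assert (K1 : J (t0 - d) - J r <= 2 * eps * (t0 - d - r)).
  { eapply MVT_le; [lra | intros; apply dJ; lra |]. simpl. intros t Ht.
    pose proof (HB t ltac:(lra)).
    assert (0 * (1 - r - r) <= RInt (fun x => G t x) r (1 - r)).
    { apply RInt_ge_subinterval; try lra; intros; try (apply cGx; lra); apply G0, inO; lra. }
    lra. }
  assert (K3 : J (T - r) - J (t0 + d) <= 2 * eps * (T - r - (t0 + d))).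
  { eapply MVT_le; [lra | intros; apply dJ; lra |]. simpl. intros t Ht.
    pose proof (HB t ltac:(lra)).
    assert (0 * (1 - r - r) <= RInt (fun x => G t x) r (1 - r)).
    { apply RInt_ge_subinterval; try lra; intros; try (apply cGx; lra); apply G0, inO; lra. }
    lra. }
  assert (K2 : J (t0 + d) - J (t0 - d) <= (2 * eps - 2 * d * c) * (t0 + d - (t0 - d))).
  { eapply MVT_le; [lra | intros; apply dJ; lra |]. simpl. intros t Ht.
    pose proof (HB t ltac:(lra)).
    assert (c * (x0 + d - (x0 - d)) <= RInt (fun x => G t x) r (1 - r)).
    { apply RInt_ge_subinterval; try lra; intros.
      - apply cGx; lra.
      - apply G0, inO; lra.
      - apply Glow; lra. }
    lra. }
  assert (HJ1 : Rabs (J r) <= eps) by (apply HJ; lra).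
  assert (HJ2 : Rabs (J (T - r)) <= eps) by (apply HJ; lra).
  pose proof (Rle_abs (J r)). pose proof (Rabs_maj2 (J (T - r))).
  assert (0 < d * d * c) by (repeat apply Rmult_lt_0_compat; lra).
  assert (eps * r > 0) by (apply Rmult_lt_0_compat; lra).
  lra.
Qed.

(** * Continuity and differentiability relative to a set *)

(** The pair [(u, v)] carries the neighbourhood filter restricted to [D] into the one restricted to
    [E]. The set [E] admits outer functions continuous on only part of the plane, such as division
    or [DpH_inv]. *)
Lemma C0_on_comp (D E : R * R -> Prop) (g u v : R -> R -> R) :
  C0_on E g -> C0_on D u -> C0_on D v ->
  (forall a b, D (a, b) -> E (u a b, v a b)) ->
  C0_on D (fun a b => g (u a b) (v a b)).
Proof.
  intros Hg Hu Hv HDE [a b] Hab. simpl.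
  intros P HP. specialize (Hg (u a b, v a b) (HDE _ _ Hab) P HP).
  destruct Hg as [e He].
  destruct (proj1 (filterlim_locally _ _) (Hu _ Hab) e) as [d1 H1].
  destruct (proj1 (filterlim_locally _ _) (Hv _ Hab) e) as [d2 H2].
  assert (Hd : 0 < Rmin d1 d2) by (apply Rmin_case; apply cond_pos).
  exists (mkposreal _ Hd). intros z Hz HDz. simpl in *.
  apply (He (u (fst z) (snd z), v (fst z) (snd z))).
  - split.
    + apply (H1 z); [| exact HDz]. apply (ball_le (a, b)) with (2 := Hz). apply Rmin_l.
    + apply (H2 z); [| exact HDz]. apply (ball_le (a, b)) with (2 := Hz). apply Rmin_r.
  - destruct z. now apply HDE.
Qed.

Lemma C0_on_of_continuity (D : R * R -> Prop) (g : R -> R -> R) :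
  (forall a b, D (a, b) -> continuity_2d_pt g a b) -> C0_on D g.
Proof.
  intros H. apply continuous_on_forall. intros [a b] HD.
  exact (proj1 (continuity_2d_pt_filterlim g a b) (H a b HD)).
Qed.

Lemma C0_on_continuity (D : R * R -> Prop) (g : R -> R -> R) (a b : R) :
  C0_on D g -> locally (a, b) D -> continuity_2d_pt g a b.
Proof.
  intros H HD. apply continuity_2d_pt_filterlim.
  exact (continuous_continuous_on D (fun z => g (fst z) (snd z)) (a, b) HD H).
Qed.

Lemma C0_on_fst (D : R * R -> Prop) : C0_on D (fun a _ => a).
Proof. apply C0_on_of_continuity; intros; apply continuity_2d_pt_id1. Qed.

Lemma C0_on_snd (D : R * R -> Prop) : C0_on D (fun _ b => b).
Proof. apply C0_on_of_continuity; intros; apply continuity_2d_pt_id2. Qed.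

Lemma C0_on_minus (D : R * R -> Prop) (u v : R -> R -> R) :
  C0_on D u -> C0_on D v -> C0_on D (fun a b => u a b - v a b).
Proof.
  intros Hu Hv. apply (C0_on_comp D (fun _ => True) Rminus); auto.
  apply C0_on_of_continuity; intros.
  apply continuity_2d_pt_minus; [apply continuity_2d_pt_id1 | apply continuity_2d_pt_id2].
Qed.

Lemma C0_on_mult (D : R * R -> Prop) (u v : R -> R -> R) :
  C0_on D u -> C0_on D v -> C0_on D (fun a b => u a b * v a b).
Proof.
  intros Hu Hv. apply (C0_on_comp D (fun _ => True) Rmult); auto.
  apply C0_on_of_continuity; intros.
  apply continuity_2d_pt_mult; [apply continuity_2d_pt_id1 | apply continuity_2d_pt_id2].
Qed.

Lemma C0_on_div (D : R * R -> Prop) (u v : R -> R -> R) :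
  C0_on D u -> C0_on D v -> (forall a b, D (a, b) -> v a b <> 0) ->
  C0_on D (fun a b => u a b / v a b).
Proof.
  intros Hu Hv H0. apply (C0_on_comp D (fun z => snd z <> 0) Rdiv); auto.
  apply C0_on_of_continuity; intros a b Hb.
  apply continuity_2d_pt_mult; [apply continuity_2d_pt_id1 |].
  apply continuity_2d_pt_inv; [apply continuity_2d_pt_id2 | exact Hb].
Qed.

Lemma C0_on_section2 (D : R * R -> Prop) (g : R -> R -> R) (a : R) :
  C0_on D g -> continuous_on (fun b => D (a, b)) (g a).
Proof.
  intros H b Hb P HP. specialize (H (a, b) Hb P HP). destruct H as [e He].
  exists e. intros y Hy HD. apply (He (a, y)); [| exact HD].
  split; [apply ball_center | exact Hy].
Qed.

(** When [D] is a neighbourhood of [x], the filters [within D (locally x)] and [locally x] contain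
    the same sets, and [filterdiff] sees a filter only through its sets. *)
Lemma is_derive_on_interior (D : R -> Prop) (f : R -> R) (x l : R) :
  locally x D -> is_derive_on D f x l <-> is_derive f x l.
Proof.
  intros HD. unfold is_derive_on, is_derive.
  assert (Hw : forall P, within D (locally x) P <-> locally x P).
  { intros P; split; intros HP.
    - unfold within in HP. generalize (filter_and _ _ HD HP). apply filter_imp. tauto.
    - unfold within. apply filter_imp with (2 := HP). auto. }
  assert (Hle : forall F F' : (R -> Prop) -> Prop, (forall P, F P <-> F' P) ->
    filterdiff f F (fun y => scal y l) -> filterdiff f F' (fun y => scal y l)).
  { intros F F' HF [Hlin Hd]. split; [exact Hlin |]. intros y Hy.
    refine (is_domin_le (F := F) _ _ _ (fun P => proj1 (HF P))).
    apply Hd. refine (is_filter_lim_filter_le (F := F') y _ Hy).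
    intros P HP; now apply HF. }
  split; apply Hle; [exact Hw | intros P; symmetry; apply Hw].
Qed.

Lemma Derive_on_interior (D : R -> Prop) (f : R -> R) (x : R) :
  locally x D -> ex_derive_on D f x -> is_derive f x (Derive_on D f x).
Proof.
  intros HD [l Hl]. apply (is_derive_on_interior D) in Hl; [| exact HD].
  replace (Derive_on D f x) with l; [exact Hl |]. symmetry.
  (* The uniqueness that [iota] requires is borrowed from the two-sided derivative. *)
  apply (iota_unique (V := R_CompleteNormedModule)).
  - intros y Hy. apply (is_derive_on_interior D) in Hy; [| exact HD].
    rewrite <- (is_derive_unique _ _ _ Hl). symmetry. now apply is_derive_unique.
  - now apply (is_derive_on_interior D).
Qed.

Lemma C1_on_derive1 (D : R * R -> Prop) (f : R -> R -> R) (a b : R) :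
  C1_on D f -> D (a, b) -> locally a (fun s => D (s, b)) ->
  is_derive (fun s => f s b) a (pderiv1 D f a b).
Proof.
  intros (_ & Hd & _) HD Hl. apply (Derive_on_interior _ (fun s => f s b) a Hl).
  now apply Hd.
Qed.

Lemma C1_on_derive2 (D : R * R -> Prop) (f : R -> R -> R) (a b : R) :
  C1_on D f -> D (a, b) -> locally b (fun s => D (a, s)) ->
  is_derive (f a) b (pderiv2 D f a b).
Proof.
  intros (_ & Hd & _) HD Hl. apply (Derive_on_interior _ (f a) b Hl).
  now apply Hd.
Qed.

(** Joint differentiability follows from one partial derivative existing nearby and being continuous
    at the point, together with the other one at the point itself. *)
Lemma C1_on_differentiable (D : R * R -> Prop) (f : R -> R -> R) (a b : R) :
  C1_on D f -> locally (a, b) D ->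
  differentiable_pt_lim f a b (pderiv1 D f a b) (pderiv2 D f a b).
Proof.
  intros Hf HD. apply filterdiff_differentiable_pt_lim.
  pose proof (locally_singleton _ _ HD) as Hab.
  apply filterdiff_ext_lin with
    (l1 := fun u : R * R => plus (scal (fst u) (pderiv1 D f a b)) (scal (snd u) (pderiv2 D f a b))).
  2: reflexivity.
  apply is_derive_filterdiff.
  - apply filter_imp with (2 := locally_locally _ _ HD). intros [u v] Huv. simpl.
    apply C1_on_derive1; [exact Hf | exact (locally_singleton _ _ Huv) |].
    now apply locally_section1.
  - apply C1_on_derive2; [exact Hf | exact Hab | now apply locally_section2].
  - destruct Hf as (_ & _ & Hc & _).
    exact (continuous_continuous_on D (fun z => pderiv1 D f (fst z) (snd z)) (a, b) HD Hc).
Qed.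

(** Uniform continuity on the closed rectangle: a point close to a side is compared with its
    projection onto that side, where [f] is zero. *)
Lemma C0_on_vanishes_at_boundary (T : R) (f : R -> R -> R) :
  0 < T -> C0_on (Omega_bar T) f -> (forall t x, bd_Omega T (t, x) -> f t x = 0) ->
  vanishes_at_boundary T f.
Proof.
  intros HT Hf H0 eps eps_pos.
  (* [uniform_continuity_2d] wants continuity in the whole plane, also at boundary points, whereas
     [f] is continuous only relative to [Omega_bar]. Clamping both coordinates extends [f]
     continuously without changing it on [Omega_bar]. *)
  pose (cl := fun b s : R => Rmax 0 (Rmin b s)).
  assert (cl_in : forall b s, 0 < b -> 0 <= cl b s <= b).
  { intros b s Hb. unfold cl. split; [apply Rmax_l |].
    apply Rmax_case; [lra | apply Rmin_l]. }
  assert (cl_id : forall b s, 0 <= s <= b -> cl b s = s).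
  { intros b s Hs. unfold cl. rewrite Rmin_right by lra. apply Rmax_right; lra. }
  assert (cl_lip : forall b s s', 0 < b -> Rabs (cl b s - cl b s') <= Rabs (s - s')).
  { intros b s s' Hb. unfold cl, Rmax, Rmin.
    repeat destruct Rle_dec; unfold Rabs; repeat destruct Rcase_abs; lra. }
  assert (cl_cont : forall b s, 0 < b -> continuity_pt (cl b) s).
  { intros b s Hb e He. exists e. split; [exact He |]. intros y [_ Hy].
    simpl in *. unfold Rdist in *. pose proof (cl_lip b y s Hb). lra. }
  pose (g := fun t x => f (cl T t) (cl 1 x)).
  assert (Hg : forall t x, continuity_2d_pt g t x).
  { intros t x. apply (C0_on_continuity (fun _ => True)); [| apply filter_true].
    apply (C0_on_comp _ (Omega_bar T) f (fun t _ => cl T t) (fun _ x => cl 1 x) Hf).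
    - apply C0_on_of_continuity. intros a b _.
      apply (continuity_1d_2d_pt_comp (cl T) (fun a _ => a));
        [now apply cl_cont | apply continuity_2d_pt_id1].
    - apply C0_on_of_continuity. intros a b _.
      apply (continuity_1d_2d_pt_comp (cl 1) (fun _ b => b));
        [apply cl_cont; lra | apply continuity_2d_pt_id2].
    - intros a b _. split; simpl; apply cl_in; lra. }
  destruct (uniform_continuity_2d g 0 T 0 1 (fun x y _ _ => Hg x y) (mkposreal _ eps_pos))
    as [d Hd]. simpl in Hd. pose proof (cond_pos d).
  exists (d / 2). split; [lra |].
  intros t x [[Ht1 Ht2] [Hx1 Hx2]] Hnear; simpl in *.
  assert (Hdist : forall t' x', bd_Omega T (t', x') -> Rabs (t - t') < d -> Rabs (x - x') < d ->
     Rabs (f t x) <= eps).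
  { intros t' x' Hb Ht Hx. pose proof (proj1 Hb) as [Hb1 Hb2]; simpl in Hb1, Hb2.
    assert (E : Rabs (g t x - g t' x') < eps) by (apply Hd; auto; lra).
    unfold g in E. rewrite !cl_id in E by lra. rewrite (H0 _ _ Hb), Rminus_0_r in E. lra. }
  assert (Hz : forall s, Rabs (s - s) < d) by (intros s; rewrite Rminus_diag; rewrite Rabs_R0; lra).
  destruct Hnear as [Hn | [Hn | [Hn | Hn]]];
    [apply (Hdist 0 x) | apply (Hdist T x) | apply (Hdist t 0) | apply (Hdist t 1)]; auto;
    try (unfold bd_Omega, Omega_bar, Omega; simpl; lra); apply Rabs_def1; lra.
Qed.

(** * Implicit functions and envelopes *)

Lemma is_derive_locally (f : R -> R) (x l : R) :
  is_derive f x l <->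
  forall eps : posreal,
    locally x (fun y => Rabs (f y - f x - l * (y - x)) <= eps * Rabs (y - x)).
Proof.
  assert (E : forall y, minus (minus (f y) (f x)) (scal (minus y x) l)
                        = f y - f x - l * (y - x)).
  { intros y. unfold minus, plus, opp, scal; simpl. unfold mult; simpl. ring. }
  split.
  - intros [_ H] eps. specialize (H x (fun P HP => HP) eps).
    revert H. apply filter_imp. intros y Hy. rewrite E in Hy. exact Hy.
  - intros H. split; [apply is_linear_scal_l |].
    intros y Hy eps.
    rewrite <- (is_filter_lim_locally_unique (V := R_NormedModule) x y Hy).
    generalize (H eps). apply filter_imp. intros z Hz. rewrite E. exact Hz.
Qed.

(** An abstract envelope theorem: the increment of [f] is trapped between those with slopes [g a]
    and [g y], which merge as [y] tends to [a]. The product form covers both signs of [y - a]. *)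
Lemma is_derive_squeeze (f g : R -> R) (a : R) :
  continuous g a ->
  locally a (fun y => g a * (y - a) <= f y - f a <= g y * (y - a)) ->
  is_derive f a (g a).
Proof.
  intros Hg Hf. apply is_derive_locally. intros eps.
  generalize (filter_and _ _ Hf (proj1 (filterlim_locally _ _) Hg eps)).
  apply filter_imp. intros y [Hy Hb]. change (Rabs (g y - g a) < eps) in Hb.
  rewrite Rabs_pos_eq by lra.
  apply Rle_trans with (Rabs ((g y - g a) * (y - a))).
  - eapply Rle_trans; [| apply Rle_abs]. lra.
  - rewrite Rabs_mult. apply Rmult_le_compat_r; [apply Rabs_pos | lra].
Qed.

(** Serves to apply [is_derive_implicit] to [DpH H x] with [x] frozen, when only time varies. *)
Lemma differentiable_pt_lim_snd (f : R -> R) (x y l : R) :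
  is_derive f y l -> differentiable_pt_lim (fun _ v => f v) x y 0 l.
Proof.
  intros Hf eps. destruct (proj1 (is_derive_locally f y l) Hf eps) as [d Hd].
  exists d. intros u v _ Hv. rewrite Rmult_0_l, Rplus_0_l.
  eapply Rle_trans; [exact (Hd v Hv) |].
  apply Rmult_le_compat_l; [left; apply cond_pos | apply Rmax_r].
Qed.

(** Let [h] and [k] be the increments of the argument and of [P]. Expanding [g] along the graph of
    [P], which continuity keeps close to [(x, P x)], gives [b * k = (q' - a) * h] up to a small
    multiple of [|h| + |k|]. A crude bound [|k| <= C * |h|] then makes the error small relative to
    [|h|]. *)
Lemma is_derive_implicit (g : R -> R -> R) (P q : R -> R) (x a b q' : R) :
  differentiable_pt_lim g x (P x) a b -> b <> 0 ->
  continuous P x -> is_derive q x q' ->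
  locally x (fun y => g y (P y) = q y) ->
  is_derive P x ((q' - a) / b).
Proof.
  intros Hg Hb HP Hq Himpl.
  assert (b_pos : 0 < Rabs b) by now apply Rabs_pos_lt.
  (* This is the constant that results from absorbing the [|k|] term on the left when the error
     factor is at most [|b| / 2]. *)
  pose (C := 2 * (Rabs (q' - a) + Rabs b) / Rabs b).
  assert (C_pos : 0 <= C).
  { unfold C. apply Rmult_le_pos; [| left; now apply Rinv_0_lt_compat].
    pose proof (Rabs_pos (q' - a)). lra. }
  apply is_derive_locally. intros eps. pose proof (cond_pos eps).
  (* The first bound permits that absorption; the second turns the final error [eta * (2 + C) * |h|]
     into at most [eps * |b| * |h|]. *)
  assert (exists eta : posreal, eta <= Rabs b / 2 /\ eta * (2 + C) <= eps * Rabs b)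
    as (eta & He1 & He2).
  { assert (H0 : 0 < Rmin (Rabs b / 2) (eps * Rabs b / (2 + C))).
    { apply Rmin_case; [lra |]. apply Rdiv_lt_0_compat; [| lra].
      now apply Rmult_lt_0_compat. }
    exists (mkposreal _ H0). simpl. split; [apply Rmin_l |].
    apply Rle_trans with (eps * Rabs b / (2 + C) * (2 + C)); [| right; field; lra].
    apply Rmult_le_compat_r; [lra | apply Rmin_r]. }
  destruct (Hg eta) as [d Hd].
  generalize (filter_and _ _ (filter_and _ _ Himpl (proj1 (is_derive_locally q x q') Hq eta))
    (filter_and _ _ (proj1 (filterlim_locally _ _) HP d) (locally_ball x d))).
  apply filter_imp. intros y [[Ey Hqy] [HPy Hy]].
  change (Rabs (P y - P x) < d) in HPy. change (Rabs (y - x) < d) in Hy.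
  specialize (Hd y (P y) Hy HPy).
  rewrite Ey, (locally_singleton _ _ Himpl) in Hd.
  set (h := y - x) in *. set (k := P y - P x) in *.
  assert (Hmax : Rmax (Rabs h) (Rabs k) <= Rabs h + Rabs k).
  { pose proof (Rabs_pos h). pose proof (Rabs_pos k). apply Rmax_case; lra. }
  assert (Hd' : Rabs (q y - q x - (a * h + b * k)) <= eta * (Rabs h + Rabs k)).
  { eapply Rle_trans; [exact Hd |]. apply Rmult_le_compat_l; [left; apply cond_pos | exact Hmax]. }
  assert (Hk : Rabs (b * k - (q' - a) * h) <= eta * (2 * Rabs h + Rabs k)).
  { replace (b * k - (q' - a) * h) with
      ((q y - q x - q' * h) - (q y - q x - (a * h + b * k))) by ring.
    eapply Rle_trans; [apply Rabs_triang |]. rewrite Rabs_Ropp. lra. }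
  assert (HkC : Rabs k <= C * Rabs h).
  { assert (H1 : Rabs (b * k) <= Rabs (q' - a) * Rabs h + eta * (2 * Rabs h + Rabs k)).
    { replace (b * k) with ((b * k - (q' - a) * h) + (q' - a) * h) by ring.
      eapply Rle_trans; [apply Rabs_triang |]. rewrite (Rabs_mult (q' - a)). lra. }
    rewrite Rabs_mult in H1.
    assert (H2 : eta * (2 * Rabs h + Rabs k) <= Rabs b / 2 * (2 * Rabs h + Rabs k)).
    { apply Rmult_le_compat_r; [| exact He1].
      pose proof (Rabs_pos h). pose proof (Rabs_pos k). lra. }
    apply Rmult_le_reg_l with (Rabs b / 2); [lra |].
    replace (Rabs b / 2 * (C * Rabs h)) with ((Rabs (q' - a) + Rabs b) * Rabs h)
      by (unfold C; field; lra).
    lra. }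
  apply Rmult_le_reg_l with (Rabs b); [exact b_pos |].
  rewrite <- Rabs_mult.
  replace (b * (k - (q' - a) / b * h)) with (b * k - (q' - a) * h) by (field; exact Hb).
  eapply Rle_trans; [exact Hk |].
  apply Rle_trans with (eta * (2 + C) * Rabs h).
  - rewrite Rmult_assoc. apply Rmult_le_compat_l; [left; apply cond_pos | lra].
  - replace (Rabs b * (eps * Rabs h)) with (eps * Rabs b * Rabs h) by ring.
    apply Rmult_le_compat_r; [apply Rabs_pos | exact He2].
Qed.

(** * The Hamiltonian and the perspective function *)

Definition tonelli (H : R -> R -> R) : Prop :=
  C1_on strip H /\ C1_on strip (DpH H) /\
  (forall x, I01 x ->
     is_lim (fun p => H x p / Rabs p) p_infty p_infty /\
     is_lim (fun p => H x p / Rabs p) m_infty p_infty) /\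
  (forall x p, I01 x -> 0 < DppH H x p).

(** Vertical sections of [strip] are the whole line, so the relative derivative in [p] is two-sided
    even over [x = 0] and [x = 1]. *)
Lemma strip_pderiv2 (g : R -> R -> R) (x p : R) :
  C1_on strip g -> I01 x ->
  is_derive (g x) p (pderiv2 strip g x p) /\ Derive (g x) p = pderiv2 strip g x p.
Proof.
  intros Hg Hx.
  assert (Hd : is_derive (g x) p (pderiv2 strip g x p)).
  { apply C1_on_derive2; [exact Hg | exact Hx |]. apply filter_forall. intros; exact Hx. }
  split; [exact Hd | now apply is_derive_unique].
Qed.

Lemma is_derive_H (H : R -> R -> R) (x p : R) :
  tonelli H -> I01 x -> is_derive (H x) p (DpH H x p).
Proof.
  intros [HH _] Hx. destruct (strip_pderiv2 H x p HH Hx) as [Hd E].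
  unfold DpH. change (fun q => H x q) with (H x). now rewrite E.
Qed.

Lemma is_derive_DpH (H : R -> R -> R) (x p : R) :
  tonelli H -> I01 x -> is_derive (DpH H x) p (DppH H x p).
Proof.
  intros (_ & HH & _) Hx. destruct (strip_pderiv2 (DpH H) x p HH Hx) as [Hd E].
  unfold DppH. change (fun q => DpH H x q) with (DpH H x). now rewrite E.
Qed.

Lemma C0_on_DppH (H : R -> R -> R) : tonelli H -> C0_on strip (DppH H).
Proof.
  intros (_ & HH & _).
  apply (continuous_on_ext strip (fun z => pderiv2 strip (DpH H) (fst z) (snd z))).
  - intros [x p] Hx. symmetry. now apply strip_pderiv2.
  - apply HH.
Qed.

Lemma DpH_increasing (H : R -> R -> R) (x p q : R) :
  tonelli H -> I01 x -> p < q -> DpH H x p < DpH H x q.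
Proof.
  intros HH Hx Hpq.
  destruct (MVT_cor2 (DpH H x) (DppH H x) p q Hpq) as [c [E _]].
  { intros c _. apply is_derive_Reals. now apply is_derive_DpH. }
  assert (0 < DppH H x c * (q - p)).
  { apply Rmult_lt_0_compat; [now apply HH | lra]. }
  lra.
Qed.

Lemma H_above_tangent_strict (H : R -> R -> R) (x p q : R) :
  tonelli H -> I01 x -> p <> q -> H x p + DpH H x p * (q - p) < H x q.
Proof.
  intros HH Hx Hpq.
  assert (Hd : forall c, derivable_pt_lim (H x) c (DpH H x c)).
  { intros c. apply is_derive_Reals. now apply is_derive_H. }
  destruct (Rdichotomy p q Hpq) as [L | L].
  - destruct (MVT_cor2 (H x) (DpH H x) p q L (fun c _ => Hd c)) as [c [E Hc]].
    assert (DpH H x p * (q - p) < DpH H x c * (q - p)).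
    { apply Rmult_lt_compat_r; [lra | apply DpH_increasing; auto; lra]. }
    lra.
  - destruct (MVT_cor2 (H x) (DpH H x) q p L (fun c _ => Hd c)) as [c [E Hc]].
    assert (DpH H x c * (p - q) < DpH H x p * (p - q)).
    { apply Rmult_lt_compat_r; [lra | apply DpH_increasing; auto; lra]. }
    lra.
Qed.

Lemma H_above_tangent (H : R -> R -> R) (x p q : R) :
  tonelli H -> I01 x -> H x p + DpH H x p * (q - p) <= H x q.
Proof.
  intros HH Hx. destruct (Req_dec p q) as [E | NE].
  - subst q. lra.
  - left. now apply H_above_tangent_strict.
Qed.

(** The tangent at [p], evaluated at 0, gives [p * DpH H x p >= H x p - H x 0]. Superlinearity then
    pushes the slope above [v] for large positive [p] and below [v] for large negative [p], and the
    intermediate value theorem concludes. *)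
Lemma DpH_surjective (H : R -> R -> R) (x v : R) :
  tonelli H -> I01 x -> exists p, DpH H x p = v.
Proof.
  intros HH Hx. pose proof HH as (_ & _ & Hsup & _). destruct (Hsup x Hx) as [Sp Sm].
  apply is_lim_spec in Sp, Sm. simpl in Sp, Sm.
  (* For [|p| >= 1], a value [H x p > K * |p|] exceeds [H x 0] by more than [|v| * |p|]. *)
  pose (K := Rabs v + Rabs (H x 0)).
  assert (Hp2 : exists p, v <= DpH H x p).
  { destruct (Sp K) as [M HM]. pose (p := Rmax M 0 + 1).
    assert (p_pos : 1 <= p) by (unfold p; pose proof (Rmax_r M 0); lra).
    assert (pM : M < p) by (unfold p; pose proof (Rmax_l M 0); lra).
    specialize (HM p pM). rewrite Rabs_pos_eq in HM by lra. exists p.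
    pose proof (H_above_tangent H x p 0 HH Hx) as Ht.
    assert (Hlt : K * p < H x p).
    { replace (H x p) with (H x p / p * p) by (field; lra). apply Rmult_lt_compat_r; lra. }
    apply Rmult_le_reg_r with p; [lra |].
    assert (v * p <= Rabs v * p) by (apply Rmult_le_compat_r; [lra | apply Rle_abs]).
    assert (Rabs (H x 0) * 1 <= Rabs (H x 0) * p)
      by (apply Rmult_le_compat_l; [apply Rabs_pos | lra]).
    pose proof (Rle_abs (H x 0)). unfold K in Hlt. lra. }
  assert (Hp1 : exists p, DpH H x p <= v).
  { destruct (Sm K) as [M HM]. pose (p := Rmin M 0 - 1).
    assert (p_neg : p <= -1) by (unfold p; pose proof (Rmin_r M 0); lra).
    assert (pM : p < M) by (unfold p; pose proof (Rmin_l M 0); lra).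
    specialize (HM p pM). rewrite Rabs_left in HM by lra. exists p.
    pose proof (H_above_tangent H x p 0 HH Hx) as Ht.
    assert (Hlt : K * - p < H x p).
    { replace (H x p) with (H x p / - p * - p) by (field; lra). apply Rmult_lt_compat_r; lra. }
    apply Rmult_le_reg_r with (- p); [lra |].
    assert (- v * - p <= Rabs v * - p)
      by (apply Rmult_le_compat_r; [lra | apply Rabs_maj2]).
    assert (Rabs (H x 0) * 1 <= Rabs (H x 0) * - p)
      by (apply Rmult_le_compat_l; [apply Rabs_pos | lra]).
    pose proof (Rle_abs (H x 0)). unfold K in Hlt. lra. }
  destruct Hp1 as [p1 H1], Hp2 as [p2 H2].
  destruct (IVT_gen (DpH H x) p1 p2 v) as [p [_ Ep]].
  - intros p. apply continuity_pt_filterlim. apply (ex_derive_continuous (DpH H x)).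
    eexists. now apply is_derive_DpH.
  - rewrite Rmin_left, Rmax_right by lra. lra.
  - now exists p.
Qed.

(** In terms of the Lagrangian this is $-L_v(x,-v)$, the momentum belonging to the velocity. *)
Definition DpH_inv (H : R -> R -> R) (x v : R) : R :=
  iota (fun p : R => DpH H x p = v).

Lemma DpH_inv_l (H : R -> R -> R) (x p : R) :
  tonelli H -> I01 x -> DpH_inv H x (DpH H x p) = p.
Proof.
  intros HH Hx. apply (iota_unique (V := R_CompleteNormedModule)); [| reflexivity].
  intros y Hy. destruct (Rtotal_order y p) as [L | [E | L]]; [| exact E |];
    apply (DpH_increasing H x) in L; auto; lra.
Qed.

Lemma DpH_inv_r (H : R -> R -> R) (x v : R) :
  tonelli H -> I01 x -> DpH H x (DpH_inv H x v) = v.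
Proof.
  intros HH Hx. destruct (DpH_surjective H x v HH Hx) as [p <-].
  now rewrite DpH_inv_l.
Qed.

(** With [p] the inverse at [(x, v)], the strict inequalities
    [DpH H x (p - e) < v < DpH H x (p + e)] persist for nearby [(y, w)] in [strip], and monotonicity
    traps the new inverse within [e] of [p]. This gives joint continuity, endpoints of [[0,1]]
    included. *)
Lemma C0_on_DpH_inv (H : R -> R -> R) : tonelli H -> C0_on strip (DpH_inv H).
Proof.
  intros HH [x v] Hx. simpl. unfold strip in Hx; simpl in Hx.
  apply filterlim_locally. intros e. pose proof (cond_pos e).
  set (p := DpH_inv H x v).
  assert (Hc : forall c, filterlim (fun z => DpH H (fst z) c - snd z)
                (within strip (locally (x, v))) (locally (DpH H x c - v))).
  { intros c.
    assert (K : C0_on strip (fun x v => DpH H x c - v)).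
    { apply C0_on_minus; [| apply C0_on_snd].
      apply (C0_on_comp strip strip (DpH H) (fun x _ => x) (fun _ _ => c)).
      - apply HH.
      - apply C0_on_fst.
      - apply C0_on_of_continuity; intros; apply continuity_2d_pt_const.
      - intros a b Hab; exact Hab. }
    exact (K (x, v) Hx). }
  assert (Lo : DpH H x (p - e) - v < 0).
  { pose proof (DpH_increasing H x (p - e) p HH Hx ltac:(lra)).
    unfold p in *. rewrite DpH_inv_r in *; auto. lra. }
  assert (Hi : 0 < DpH H x (p + e) - v).
  { pose proof (DpH_increasing H x p (p + e) HH Hx ltac:(lra)).
    unfold p in *. rewrite (DpH_inv_r H x v) in *; auto. lra. }
  pose proof (Hc _ _ (open_lt 0 _ Lo)) as N1. pose proof (Hc _ _ (open_gt 0 _ Hi)) as N2.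
  unfold filtermap, within in N1, N2 |- *.
  generalize (filter_and _ _ N1 N2). apply filter_imp.
  intros [y w] [M1 M2] Hy. unfold strip in Hy, M1, M2; simpl in Hy, M1, M2 |- *.
  specialize (M1 Hy). specialize (M2 Hy).
  set (r := DpH_inv H y w). assert (Er : DpH H y r = w) by now apply DpH_inv_r.
  apply Rabs_def1; unfold minus, plus, opp; simpl; fold r.
  - destruct (Rlt_or_le r (p + e)) as [L | [L | L]]; [lra | |].
    + apply (DpH_increasing H y) in L; auto. lra.
    + rewrite <- L in *. lra.
  - destruct (Rlt_or_le (p - e) r) as [L | [L | L]]; [lra | |].
    + apply (DpH_increasing H y) in L; auto. lra.
    + rewrite L in *. lra.
Qed.

Lemma continuous_DpH_inv (H : R -> R -> R) (x v : R) :
  tonelli H -> I01 x -> continuous (DpH_inv H x) v.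
Proof.
  intros HH Hx. apply (continuous_continuous_on (fun _ => I01 x)).
  - now apply filter_forall.
  - exact (C0_on_section2 strip (DpH_inv H) x (C0_on_DpH_inv H HH)).
Qed.

(** The supremum is attained where [- j - m * DpH H x p = 0]; the tangent inequality scaled by [m]
    shows optimality. The second conjunct lets any [p] act as a competitor in the envelope
    arguments. *)
Lemma F_max_at_DpH_inv (H : R -> R -> R) (x j m p : R) :
  tonelli H -> I01 x -> 0 < m ->
  real (F H x j m) = - j * DpH_inv H x (- j / m) - m * H x (DpH_inv H x (- j / m)) /\
  - j * p - m * H x p <= real (F H x j m).
Proof.
  intros HH Hx Hm. set (p0 := DpH_inv H x (- j / m)).
  assert (Hmax : forall q, - j * q - m * H x q <= - j * p0 - m * H x p0).
  { intros q. pose proof (H_above_tangent H x p0 q HH Hx) as Ht.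
    unfold p0 in Ht at 2. rewrite DpH_inv_r in Ht by assumption.
    apply Rmult_le_compat_l with (r := m) in Ht; [| lra].
    replace (m * (H x p0 + - j / m * (q - p0))) with (m * H x p0 - j * (q - p0)) in Ht
      by (field; lra).
    lra. }
  assert (E : F H x j m = Finite (- j * p0 - m * H x p0)).
  { apply is_lub_Rbar_unique. split.
    - intros y [q ->]. simpl. apply Hmax.
    - intros b Hb. apply Hb. now exists p0. }
  rewrite E. simpl. split; [reflexivity | apply Hmax].
Qed.

(** The optimal momenta at two values of [j] are competitors for each other, and the two resulting
    inequalities are exactly the squeeze. *)
Lemma F_j_eq (H : R -> R -> R) (x j m : R) :
  tonelli H -> I01 x -> 0 < m -> F_j H x j m = - DpH_inv H x (- j / m).
Proof.
  intros HH Hx Hm. apply is_derive_unique.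
  apply (is_derive_squeeze (fun j => real (F H x j m)) (fun j => - DpH_inv H x (- j / m))).
  - apply (continuous_opp (V := R_NormedModule)).
    apply (continuous_comp (fun j => - j / m) (DpH_inv H x)).
    + apply (ex_derive_continuous (fun j => - j / m)). auto_derive. lra.
    + now apply continuous_DpH_inv.
  - apply filter_forall. intros k.
    pose proof (F_max_at_DpH_inv H x k m (DpH_inv H x (- j / m)) HH Hx Hm).
    pose proof (F_max_at_DpH_inv H x j m (DpH_inv H x (- k / m)) HH Hx Hm).
    lra.
Qed.

Lemma F_m_eq (H : R -> R -> R) (x j m : R) :
  tonelli H -> I01 x -> 0 < m -> F_m H x j m = - H x (DpH_inv H x (- j / m)).
Proof.
  intros HH Hx Hm. apply is_derive_unique.
  apply (is_derive_squeeze (fun m => real (F H x j m)) (fun m => - H x (DpH_inv H x (- j / m)))).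
  - apply (continuous_opp (V := R_NormedModule)).
    apply (continuous_comp (fun m => DpH_inv H x (- j / m)) (H x)).
    + apply (continuous_comp (fun m => - j / m) (DpH_inv H x)).
      * apply (ex_derive_continuous (fun m => - j / m)). auto_derive. lra.
      * now apply continuous_DpH_inv.
    + apply (ex_derive_continuous (H x)). eexists. now apply is_derive_H.
  (* The same exchange of competitors, restricted to [k] near [m] so that [k > 0]. *)
  - generalize (open_gt 0 m Hm). apply filter_imp. intros k Hk.
    pose proof (F_max_at_DpH_inv H x j k (DpH_inv H x (- j / m)) HH Hx Hk).
    pose proof (F_max_at_DpH_inv H x j m (DpH_inv H x (- j / k)) HH Hx Hm).
    lra.
Qed.

(** * Uniqueness *)

Lemma Omega_bar_near (T t x : R) : Omega T (t, x) -> locally (t, x) (Omega_bar T).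
Proof.
  intros Hz. generalize (Omega_open T t x Hz). apply filter_imp.
  intros [u v] [Hu Hv]. split; simpl in *; lra.
Qed.

Lemma Omega_derive1 (T : R) (f : R -> R -> R) (t x : R) :
  C1_on (Omega_bar T) f -> Omega T (t, x) ->
  is_derive (fun s => f s x) t (pderiv1 (Omega_bar T) f t x).
Proof.
  intros Hf Hz. pose proof (Omega_bar_near _ _ _ Hz) as Hl.
  apply C1_on_derive1; [exact Hf | exact (locally_singleton _ _ Hl) | now apply locally_section1].
Qed.

Lemma Omega_derive2 (T : R) (f : R -> R -> R) (t x : R) :
  C1_on (Omega_bar T) f -> Omega T (t, x) ->
  is_derive (f t) x (pderiv2 (Omega_bar T) f t x).
Proof.
  intros Hf Hz. pose proof (Omega_bar_near _ _ _ Hz) as Hl.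
  apply C1_on_derive2; [exact Hf | exact (locally_singleton _ _ Hl) | now apply locally_section2].
Qed.

(* [P] plays the role of [u_x], where [u] is the value function of the
   mean-field game whose density is [phi_x]. *)
Lemma classical_solution_costate (T : R) (H : R -> R -> R) (m0 mT : R -> R)
    (phi : R -> R -> R) :
  tonelli H -> classical_solution T H m0 mT phi ->
  exists P Pt : R -> R -> R,
    C0_on (Omega_bar T) P /\
    forall t x, Omega T (t, x) ->
      is_derive (fun s => P s x) t (Pt t x) /\
      continuity_2d_pt Pt t x /\
      is_derive (fun y => H y (P t y)) x (Pt t x + pderiv2 (Omega_bar T) phi t x) /\
      pderiv2 (Omega_bar T) phi t x * DpH H x (P t x) = pderiv1 (Omega_bar T) phi t x.
Proof.
  intros HH ((Hphi & Ht & Hx) & Hpos & Heq & _).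
  set (phi_t := pderiv1 (Omega_bar T) phi) in *.
  set (phi_x := pderiv2 (Omega_bar T) phi) in *.
  pose (q := fun t x => phi_t t x / phi_x t x).
  pose (P := fun t x => DpH_inv H x (q t x)).
  pose (qt := fun t x => (pderiv1 (Omega_bar T) phi_t t x * phi_x t x
                          - pderiv1 (Omega_bar T) phi_x t x * phi_t t x)
                         / (phi_x t x * phi_x t x)).
  (* Differentiating [DpH H x P = q] in time at fixed [x] gives [DppH * Pt = qt]. The explicit
     quotient makes continuity of [Pt] immediate. *)
  pose (Pt := fun t x => qt t x / DppH H x (P t x)).
  assert (I_bar : forall t x, Omega_bar T (t, x) -> I01 x) by (intros t x [_ K]; exact K).
  assert (O_bar : forall t x, Omega T (t, x) -> Omega_bar T (t, x)).
  { intros t x Hz. exact (locally_singleton _ _ (Omega_bar_near _ _ _ Hz)). }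
  assert (nz : forall t x, Omega_bar T (t, x) -> phi_x t x <> 0).
  { intros t x Hz. pose proof (Hpos t x Hz). lra. }
  assert (cq : C0_on (Omega_bar T) q).
  { apply C0_on_div; [apply Ht | apply Hx | exact nz]. }
  assert (cP : C0_on (Omega_bar T) P).
  { apply (C0_on_comp _ strip (DpH_inv H) (fun _ x => x) q);
      [now apply C0_on_DpH_inv | apply C0_on_snd | exact cq | exact I_bar]. }
  assert (cPt : C0_on (Omega_bar T) Pt).
  { apply C0_on_div.
    - apply C0_on_div.
      + apply C0_on_minus; apply C0_on_mult; first [apply Ht | apply Hx].
      + apply C0_on_mult; apply Hx.
      + intros t x Hz. now apply Rmult_integral_contrapositive_currified; apply nz.
    - apply (C0_on_comp _ strip (DppH H) (fun _ x => x) P);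
        [now apply C0_on_DppH | apply C0_on_snd | exact cP | exact I_bar].
    - intros t x Hz. apply Rgt_not_eq. apply HH. now apply (I_bar t). }
  assert (EP : forall t x, Omega_bar T (t, x) -> DpH H x (P t x) = q t x).
  { intros t x Hz. apply DpH_inv_r; [exact HH | now apply (I_bar t)]. }
  assert (dP : forall t x, Omega T (t, x) -> is_derive (fun s => P s x) t (Pt t x)).
  { intros t x Hz. pose proof (Omega_bar_near _ _ _ Hz) as Hl.
    (* The subtracted 0 is the derivative of the relation in its first slot, absent because [x] is
       frozen. *)
    unfold Pt. rewrite <- (Rminus_0_r (qt t x)).
    apply (is_derive_implicit (fun _ p => DpH H x p) (fun s => P s x) (fun s => q s x)).
    - apply differentiable_pt_lim_snd.
      apply is_derive_DpH; [exact HH | now apply (I_bar t), O_bar].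
    - apply Rgt_not_eq. apply HH. now apply (I_bar t), O_bar.
    - apply continuity_2d_pt_section1 with (f := P). now apply (C0_on_continuity (Omega_bar T)).
    - replace (qt t x) with
        ((pderiv1 (Omega_bar T) phi_t t x * phi_x t x
          - phi_t t x * pderiv1 (Omega_bar T) phi_x t x) / phi_x t x ^ 2)
        by (unfold qt; field; now apply nz, O_bar).
      apply (is_derive_div (fun s => phi_t s x) (fun s => phi_x s x));
        [now apply Omega_derive1 | now apply Omega_derive1 | now apply nz, O_bar].
    - apply (locally_section1 (fun z => DpH H x (P (fst z) x) = q (fst z) x) t x).
      apply locally_section1 in Hl. destruct Hl as [e He]. exists e.
      intros [s y] [Hs _]. simpl. apply EP. now apply He. }
  exists P, Pt. split; [exact cP |]. intros t x Hz.
  pose proof (Omega_bar_near _ _ _ Hz) as Hl.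
  pose proof (O_bar _ _ Hz) as Hzb. pose proof (I_bar _ _ Hzb) as HI.
  assert (strip_near : locally (x, P t x) strip).
  { destruct (locally_section2 _ _ _ Hl) as [e He]. exists e.
    intros [y p] [Hy _]. exact (I_bar _ _ (He y Hy)). }
  split; [now apply dP |]. split; [now apply (C0_on_continuity (Omega_bar T)) |].
  split; [| rewrite EP by assumption; unfold q; field; now apply nz].
  assert (exP : ex_derive (P t) x).
  { assert (exq : ex_derive (q t) x).
    { apply ex_derive_div.
      - eexists. apply (Omega_derive2 T phi_t t x Ht Hz).
      - eexists. apply (Omega_derive2 T phi_x t x Hx Hz).
      - now apply nz. }
    destruct exq as [q' Hq'].
    eexists. apply (is_derive_implicit (DpH H) (P t) (q t) x
      (pderiv1 strip (DpH H) x (P t x)) (pderiv2 strip (DpH H) x (P t x)) q').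
    - apply C1_on_differentiable; [apply HH | exact strip_near].
    - rewrite <- (proj2 (strip_pderiv2 (DpH H) x (P t x) (proj1 (proj2 HH)) HI)).
      apply Rgt_not_eq. now apply HH.
    - apply continuity_2d_pt_section2 with (f := P). now apply (C0_on_continuity (Omega_bar T)).
    - exact Hq'.
    - generalize (locally_section2 _ _ _ Hl). apply filter_imp. intros y Hy. now apply EP. }
  destruct exP as [P' HP'].
  (* [Derive] is total, so the equation alone does not show that this derivative exists. Existence
     comes from the chain rule; the value is then read off the equation. *)
  assert (exH : ex_derive (fun y => H y (P t y)) x).
  { eexists. apply is_derive_Reals.
    apply (derivable_pt_lim_comp_2d H (fun y => y) (P t) x).
    - apply C1_on_differentiable; [apply HH | exact strip_near].
    - apply derivable_pt_lim_id.
    - apply is_derive_Reals. exact HP'. }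
  replace (Pt t x + phi_x t x) with (Derive (fun y => H y (P t y)) x);
    [now apply Derive_correct |].
  specialize (Heq t x Hz).
  assert (E1 : Derive (fun s => F_j H x (- phi_t s x) (phi_x s x)) t = - Pt t x).
  { apply is_derive_unique.
    apply is_derive_ext_loc with (f := fun s => - P s x).
    - generalize (locally_section1 _ _ _ Hl). apply filter_imp. intros s Hs.
      rewrite F_j_eq; [| exact HH | exact HI | now apply Hpos].
      unfold P, q. now rewrite Ropp_involutive.
    - apply (is_derive_opp (fun s => P s x)). now apply dP. }
  assert (E2 : Derive (fun y => - F_m H y (- phi_t t y) (phi_x t y)) x
               = Derive (fun y => H y (P t y)) x).
  { apply Derive_ext_loc.
    generalize (locally_section2 _ _ _ Hl). apply filter_imp. intros y Hy.
    rewrite F_m_eq; [| exact HH | now apply (I_bar t) | now apply Hpos].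
    unfold P, q. now rewrite !Ropp_involutive. }
  rewrite E1, E2 in Heq. lra.
Qed.

Lemma C0_on_H_comp (T : R) (H P : R -> R -> R) :
  tonelli H -> C0_on (Omega_bar T) P -> C0_on (Omega_bar T) (fun t x => H x (P t x)).
Proof.
  intros HH HP. apply (C0_on_comp _ strip H (fun _ x => x) P).
  - apply HH.
  - apply C0_on_snd.
  - exact HP.
  - intros t x [_ Hx]; exact Hx.
Qed.

(** Grouped by the weights [m1] and [m2], the expression is a positive combination of the gaps
    between [H x] and its tangents at [p1] and [p2], both strict by convexity. *)
Lemma bregman_sum_pos (H : R -> R -> R) (x p1 p2 m1 m2 : R) :
  tonelli H -> I01 x -> 0 < m1 -> 0 < m2 -> p1 <> p2 ->
  0 < (p1 - p2) * (m1 * DpH H x p1 - m2 * DpH H x p2) - (H x p1 - H x p2) * (m1 - m2).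
Proof.
  intros HH Hx Hm1 Hm2 Hp.
  pose proof (H_above_tangent_strict H x p1 p2 HH Hx Hp) as L1.
  pose proof (H_above_tangent_strict H x p2 p1 HH Hx (not_eq_sym Hp)) as L2.
  replace (_ - _) with
    (m1 * (H x p2 - (H x p1 + DpH H x p1 * (p2 - p1)))
     + m2 * (H x p1 - (H x p2 + DpH H x p2 * (p1 - p2)))) by ring.
  apply Rplus_lt_0_compat; apply Rmult_lt_0_compat; lra.
Qed.

(** At fixed time [w] is constant in [x], and it becomes arbitrarily small near the side [x = 0]. *)
Lemma zero_of_x_derivative_zero (T : R) (w : R -> R -> R) :
  0 < T -> C0_on (Omega_bar T) w ->
  (forall t x, bd_Omega T (t, x) -> w t x = 0) ->
  (forall t x, Omega T (t, x) -> is_derive (w t) x 0) ->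
  forall t x, Omega_bar T (t, x) -> w t x = 0.
Proof.
  intros HT Hw Hb Hd.
  assert (HO : forall t x, Omega T (t, x) -> w t x = 0).
  { intros t x Hz. apply Rabs_eq_0. apply Rle_antisym; [| apply Rabs_pos].
    apply Rnot_lt_le. intros Hlt.
    destruct (C0_on_vanishes_at_boundary T w HT Hw Hb (Rabs (w t x) / 2)) as (r & r0 & Hr); [lra |].
    destruct Hz as [Ht [Hx1 Hx2]]; simpl in *.
    (* The derivative is known only inside [Omega], so the comparison point lies near the side
       rather than on it: there [w] is at most half its value at [x], yet equal to it. *)
    pose (y := Rmin r (x / 2)).
    assert (Hy : 0 < y <= r /\ y < x).
    { unfold y. pose proof (Rmin_l r (x / 2)). pose proof (Rmin_r r (x / 2)).
      split; [split; [apply Rmin_case; lra | lra] | lra]. }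
    assert (E : w t x - w t y = 0).
    { destruct (MVT_gen (w t) y x (fun _ => 0)) as [c [_ E]];
        [intros s Hs | intros s Hs | lra]; rewrite Rmin_left, Rmax_right in Hs by lra.
      - apply Hd. unfold Omega; simpl; lra.
      - apply continuity_pt_filterlim. apply (ex_derive_continuous (w t)). exists 0.
        apply Hd. unfold Omega; simpl; lra. }
    assert (Rabs (w t y) <= Rabs (w t x) / 2).
    { apply Hr; [unfold Omega; simpl; lra | lra]. }
    replace (w t y) with (w t x) in * by lra. lra. }
  intros t x Hz. destruct (Classical_Prop.classic (Omega T (t, x))) as [Hin | Hout].
  - now apply HO.
  - apply Hb. now split.
Qed.

Theorem theorem1p2 (T : R) (H : R -> R -> R) (m0 mT : R -> R)
  (T_pos : 0 < T)
  (H_C1 : C1_on strip H)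
  (DpH_C1 : C1_on strip (DpH H))
  (H_superlinear : forall x, I01 x ->
     is_lim (fun p => H x p / Rabs p) p_infty p_infty /\
     is_lim (fun p => H x p / Rabs p) m_infty p_infty)
  (H_convex : forall x p, I01 x -> 0 < DppH H x p)
  (m0_C1 : C1_on_R I01 m0)
  (mT_C1 : C1_on_R I01 mT)
  (m0_pos : forall x, I01 x -> 0 < m0 x)
  (mT_pos : forall x, I01 x -> 0 < mT x)
  (m0_mass : RInt m0 0 1 = 1)
  (mT_mass : RInt mT 0 1 = 1) :
  forall phi psi : R -> R -> R,
    classical_solution T H m0 mT phi ->
    classical_solution T H m0 mT psi ->
    forall t x, Omega_bar T (t, x) -> phi t x = psi t x.
Proof.
  intros phi psi Hphi Hpsi.
  assert (HH : tonelli H) by (split; [| split; [| split]]; assumption).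
  destruct (classical_solution_costate T H m0 mT phi HH Hphi) as (P & Pt & cP & HP).
  destruct (classical_solution_costate T H m0 mT psi HH Hpsi) as (Q & Qt & cQ & HQ).
  destruct Hphi as ((phi_C1 & phit_C1 & phix_C1) & phix_pos & _ & phi_bd).
  destruct Hpsi as ((psi_C1 & psit_C1 & psix_C1) & psix_pos & _ & psi_bd).
  set (phi_t := pderiv1 (Omega_bar T) phi) in *. set (phi_x := pderiv2 (Omega_bar T) phi) in *.
  set (psi_t := pderiv1 (Omega_bar T) psi) in *. set (psi_x := pderiv2 (Omega_bar T) psi) in *.
  assert (O_bar : forall t x, Omega T (t, x) -> Omega_bar T (t, x)).
  { intros t x Hz. exact (locally_singleton _ _ (Omega_bar_near _ _ _ Hz)). }
  assert (cO : forall f t x, C0_on (Omega_bar T) f -> Omega T (t, x) -> continuity_2d_pt f t x).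
  { intros f t x Hf Hz. apply (C0_on_continuity (Omega_bar T)); [exact Hf |].
    now apply Omega_bar_near. }
  pose (w := fun t x => phi t x - psi t x).
  assert (cw : C0_on (Omega_bar T) w) by (apply C0_on_minus; [apply phi_C1 | apply psi_C1]).
  assert (w_bd : forall t x, bd_Omega T (t, x) -> w t x = 0).
  { intros t x Hb. unfold w. rewrite phi_bd, psi_bd by assumption. lra. }
  assert (dw1 : forall t x, Omega T (t, x) -> is_derive (fun s => w s x) t (phi_t t x - psi_t t x)).
  { intros t x Hz. apply (is_derive_minus (fun s => phi s x) (fun s => psi s x));
      now apply Omega_derive1. }
  assert (dw2 : forall t x, Omega T (t, x) -> is_derive (w t) x (phi_x t x - psi_x t x)).
  { intros t x Hz. apply (is_derive_minus (phi t) (psi t)); now apply Omega_derive2. }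
  pose (A := fun t x => (Q t x - P t x) * w t x).
  pose (At := fun t x => (Qt t x - Pt t x) * w t x + (Q t x - P t x) * (phi_t t x - psi_t t x)).
  pose (B := fun t x => (H x (P t x) - H x (Q t x) - w t x / 2) * w t x).
  (* Written with time derivatives, as the product rule produces it and as continuity is easiest to
     see; [G_eq] brings it to the Bregman form. *)
  pose (G := fun t x => (P t x - Q t x) * (phi_t t x - psi_t t x)
                        - (H x (P t x) - H x (Q t x)) * (phi_x t x - psi_x t x)).
  assert (cA : C0_on (Omega_bar T) A) by (apply C0_on_mult; [now apply C0_on_minus | exact cw]).
  assert (cHPQ : C0_on (Omega_bar T) (fun t x => H x (P t x) - H x (Q t x))).
  { apply C0_on_minus; now apply C0_on_H_comp. }
  assert (cB : C0_on (Omega_bar T) B).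
  { apply C0_on_mult; [| exact cw]. apply C0_on_minus; [exact cHPQ |].
    apply C0_on_mult; [exact cw |].
    apply C0_on_of_continuity; intros; apply continuity_2d_pt_const. }
  assert (cG : C0_on (Omega_bar T) G).
  { apply C0_on_minus; apply C0_on_mult; try exact cHPQ; apply C0_on_minus;
      first [exact cP | exact cQ | apply phit_C1 | apply psit_C1 | apply phix_C1 | apply psix_C1]. }
  assert (G_eq : forall t x, Omega T (t, x) ->
    G t x = (P t x - Q t x) * (phi_x t x * DpH H x (P t x) - psi_x t x * DpH H x (Q t x))
            - (H x (P t x) - H x (Q t x)) * (phi_x t x - psi_x t x)).
  { intros t x Hz. unfold G.
    destruct (HP t x Hz) as (_ & _ & _ & ->), (HQ t x Hz) as (_ & _ & _ & ->). reflexivity. }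
  assert (G_pos : forall t x, Omega T (t, x) -> P t x <> Q t x -> 0 < G t x).
  { intros t x Hz NE. rewrite G_eq by assumption.
    apply bregman_sum_pos; auto. exact (proj2 (O_bar _ _ Hz)). }
  assert (G_zero : forall t x, Omega T (t, x) -> G t x = 0).
  { apply (divergence_nonpos_eq_0 T A At B G T_pos).
    - apply C0_on_vanishes_at_boundary; [exact T_pos | exact cA |].
      intros t x Hb. unfold A. rewrite w_bd by assumption. ring.
    - apply C0_on_vanishes_at_boundary; [exact T_pos | exact cB |].
      intros t x Hb. unfold B. rewrite w_bd by assumption. ring.
    - intros t x Hz. destruct (HP t x Hz) as (dP & _), (HQ t x Hz) as (dQ & _).
      apply (is_derive_mult (fun s => Q s x - P s x) (fun s => w s x));
        [| now apply dw1 | intros; apply Rmult_comm].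
      now apply (is_derive_minus (fun s => Q s x) (fun s => P s x)).
    - intros t x Hz. apply continuity_2d_pt_section2. now apply cO.
    - intros t x Hz. destruct (HP t x Hz) as (_ & cPt & _), (HQ t x Hz) as (_ & cQt & _).
      apply continuity_2d_pt_plus; apply continuity_2d_pt_mult.
      + now apply continuity_2d_pt_minus.
      + now apply cO.
      + apply continuity_2d_pt_minus; now apply cO.
      + apply continuity_2d_pt_minus; apply cO; auto; [apply phit_C1 | apply psit_C1].
    - intros t x Hz. destruct (HP t x Hz) as (_ & _ & dHP & _), (HQ t x Hz) as (_ & _ & dHQ & _).
      pose proof (dw2 t x Hz) as dw.
      (* The term [(phi_x - psi_x) * w] left over from the two equations is cancelled by the
         derivative of [w * w / 2], and [(Pt - Qt) * w] is matched by [At]. *)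
      replace (- G t x - At t x) with
        ((Pt t x + phi_x t x - (Qt t x + psi_x t x) - (phi_x t x - psi_x t x) * / 2) * w t x
         + (H x (P t x) - H x (Q t x) - w t x / 2) * (phi_x t x - psi_x t x))
        by (unfold G, At; field).
      apply (is_derive_mult (fun y => H y (P t y) - H y (Q t y) - w t y / 2) (w t));
        [| exact dw | intros; apply Rmult_comm].
      apply (is_derive_minus (fun y => H y (P t y) - H y (Q t y)) (fun y => w t y / 2)).
      + now apply (is_derive_minus (fun y => H y (P t y)) (fun y => H y (Q t y))).
      + rewrite Rmult_comm. apply (is_derive_ext (fun y => / 2 * w t y)).
        { intros y. apply Rmult_comm. }
        now apply (is_derive_scal (w t)).
    - intros t x Hz. now apply cO.
    - intros t x Hz. destruct (Req_dec (P t x) (Q t x)) as [E | NE].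
      + rewrite G_eq, E by assumption. right. ring.
      + left. now apply G_pos. }
  assert (PQ : forall t x, Omega T (t, x) -> P t x = Q t x).
  { intros t x Hz. destruct (Req_dec (P t x) (Q t x)) as [E | NE]; [exact E |].
    pose proof (G_pos t x Hz NE). pose proof (G_zero t x Hz). lra. }
  assert (phix_eq : forall t x, Omega T (t, x) -> phi_x t x - psi_x t x = 0).
  { intros t x Hz.
    destruct (HP t x Hz) as (dP & _ & dHP & _), (HQ t x Hz) as (dQ & _ & dHQ & _).
    (* [P = Q] on a neighbourhood, so the time derivatives agree, and so do the space derivatives of
       [H] along them; the difference of the two is [phi_x], respectively [psi_x]. *)
    assert (E1 : Pt t x = Qt t x).
    { rewrite <- (is_derive_unique _ _ _ dP), <- (is_derive_unique _ _ _ dQ).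
      apply Derive_ext_loc. generalize (locally_section1 _ _ _ (Omega_open T t x Hz)).
      apply filter_imp. intros s Hs. now apply PQ. }
    assert (E2 : Pt t x + phi_x t x = Qt t x + psi_x t x).
    { rewrite <- (is_derive_unique _ _ _ dHP), <- (is_derive_unique _ _ _ dHQ).
      apply Derive_ext_loc. generalize (locally_section2 _ _ _ (Omega_open T t x Hz)).
      apply filter_imp. intros y Hy. now rewrite PQ. }
    lra. }
  intros t x Hz. apply Rminus_diag_uniq.
  apply (zero_of_x_derivative_zero T w T_pos cw w_bd); [| exact Hz].
  intros s y Hs. rewrite <- (phix_eq s y Hs). now apply dw2.
Qed.
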